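(* Let $i,j$ be indices with spectral parameters $z_i,z_j\in\mathbb{C}^\times$, and let $a,b,c,d,e,f$ be colored spins. Consider two systems with fixed boundary edges $a,b,c,d,e,f$. Left system: interior edges $g,h,k$ (summed over all colored spins) and three vertices: a rotated vertex $R_{z_i,z_j}$ with (bottom-left, top-left, top-right, bottom-right) edges $(a,b,g,k)$; an ordinary vertex with parameter $z_i$ with (left, top, right, bottom) edges $(g,c,d,h)$; an ordinary vertex with parameter $z_j$ with (left, top, right, bottom) edges $(k,h,e,f)$. Right system: interior edges $j',k',l'$ (summed) and vertices: an ordinary vertex with parameter $z_j$ with (left, top, right, bottom) $(b,c,j',k')$; an ordinary vertex with parameter $z_i$ with (left, top, right, bottom) $(a,k',l',f)$; a rotated vertex $R_{z_i,z_j}$ with (bottom-left, top-left, top-right, bottom-right) $(l',j',d,e)$. Then the partition functions (sums over interior assignments of the product of vertex weights) of the two systems are equal.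
   Context: Colors form a totally ordered set; a colored spin is $+$ or a color. Weight of an ordinary vertex with parameter $z$ and (left, top, right, bottom) edges: $1$ for $(+,+,+,+)$; $z$ for $(c,d,\max(c,d),\min(c,d))$ with $c,d$ colors (possibly equal); $z$ for $(c,+,c,+)$; $z$ for $(c,+,+,c)$; $1$ for $(+,c,c,+)$; $0$ otherwise. Weight of the rotated vertex $R_{z_i,z_j}$ with (bottom-left, top-left, top-right, bottom-right) edges, for colors $R>B$: $(+,+,+,+)\mapsto z_j$; $(+,B,B,+)\mapsto z_j$; $(+,R,R,+)\mapsto z_j$; $(B,+,+,B)\mapsto z_i$; $(R,+,+,R)\mapsto z_i$; $(B,+,B,+)\mapsto z_i-z_j$; $(R,+,R,+)\mapsto z_i-z_j$; $(B,B,B,B)\mapsto z_i$; $(R,R,R,R)\mapsto z_i$; $(B,R,R,B)\mapsto z_i$; $(R,B,B,R)\mapsto z_j$; $(R,B,R,B)\mapsto z_i-z_j$; all other configurations $\mapsto 0$. (Here a single color $c$ may play the role of $R$ or $B$ in the one-color entries.) *)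

(* Defs.v *)
From mathcomp Require Import all_boot all_order all_algebra.
From mathcomp Require Import all_classical reals.
From mathcomp Require Import complex.

Set Implicit Arguments.
Unset Strict Implicit.
Unset Printing Implicit Defensive.

Import Order.TTheory GRing.Theory.
Local Open Scope classical_set_scope.
Local Open Scope ring_scope.

(* [None] is the spin +, [Some c] is the color c. *)
Definition spin (disp : Order.disp_t) (T : orderType disp) : choiceType :=
  option T.

Section Weights.
Variables (disp : Order.disp_t) (T : orderType disp) (F : fieldType).

Definition vertex_weight (z : F) (left top right bottom : spin T) : F :=
  match left, top, right, bottom with
  | None, None, None, None => 1
  | Some c, Some d, Some r, Some b =>
      if (r == Order.max c d) && (b == Order.min c d) then z else 0
  | Some c, None, Some r, None => if r == c then z else 0
  | Some c, None, None, Some b => if b == c then z else 0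
  | None, Some c, Some r, None => if r == c then 1 else 0
  | _, _, _, _ => 0
  end.

Definition rotated_weight (zi zj : F)
    (bottom_left top_left top_right bottom_right : spin T) : F :=
  match bottom_left, top_left, top_right, bottom_right with
  | None, None, None, None => zj
  | None, Some c, Some tr, None => if tr == c then zj else 0
  | Some c, None, None, Some br => if br == c then zi else 0
  | Some c, None, Some tr, None => if tr == c then zi - zj else 0
  | Some bl, Some tl, Some tr, Some br =>
      if bl == tl then
        (if (tr == bl) && (br == bl) then zi else 0)
      else if (bl < tl)%O then
        (if (tr == tl) && (br == bl) then zi else 0)
      else
        (if (tr == tl) && (br == bl) then zj
         else if (tr == bl) && (br == tl) then zi - zj else 0)
  | _, _, _, _ => 0
  end.

Definition left_state_weight (zi zj : F) (a b c d e f : spin T)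
    (s : spin T * spin T * spin T) : F :=
  let: (g, h, k) := s in
  rotated_weight zi zj a b g k * vertex_weight zi g c d h
    * vertex_weight zj k h e f.

Definition right_state_weight (zi zj : F) (a b c d e f : spin T)
    (s : spin T * spin T * spin T) : F :=
  let: (j', k', l') := s in
  vertex_weight zj b c j' k' * vertex_weight zi a k' l' f
    * rotated_weight zi zj l' j' d e.

(* The set of colors may be infinite, so the sums over interior states are
   finitely supported sums; [left_state_weight_finite] and
   [right_state_weight_finite] show that the supports are indeed finite. *)
Definition left_partition_function (zi zj : F) (a b c d e f : spin T) : F :=
  \sum_(s \in [set: spin T * spin T * spin T])
     left_state_weight zi zj a b c d e f s.

Definition right_partition_function (zi zj : F) (a b c d e f : spin T) : F :=
  \sum_(s \in [set: spin T * spin T * spin T])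
     right_state_weight zi zj a b c d e f s.

Lemma vertex_weight_neq0 (z : F) (l t r b : spin T) :
  vertex_weight z l t r b != 0 ->
  (r \in [:: None; l; t]) && (b \in [:: None; l; t]).
Proof.
case: l t r b => [l|] [t|] [r|] [b|]; rewrite /= ?eqxx // !inE /=;
  try by case: ifP => [/eqP ->|_]; rewrite ?eqxx ?orbT.
case: ifP => [/andP[/eqP-> /eqP->] _|_]; last by rewrite eqxx.
by case: (leP l t) => _; rewrite !eqxx !orbT.
Qed.

Lemma rotated_weight_neq0 (zi zj : F) (bl tl tr br : spin T) :
  rotated_weight zi zj bl tl tr br != 0 ->
  (tr \in [:: bl; tl]) && (br \in [:: bl; tl]).
Proof.
case: bl tl tr br => [bl|] [tl|] [tr|] [br|]; rewrite /= ?eqxx // !inE /=;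
  try by case: ifP => [/eqP ->|_]; rewrite ?eqxx ?orbT.
by do 5?[case: ifP => [/andP[/eqP-> /eqP->]|_]|case: ifP => _];
  rewrite ?eqxx ?orbT.
Qed.

Let finite_triples (s : seq (spin T)) :
  finite_set [set p : spin T * spin T * spin T |
    [&& p.1.1 \in s, p.1.2 \in s & p.2 \in s]].
Proof.
apply: (@sub_finite_set _ _
  (([set` s] `*` [set` s]) `*` [set` s])).
  by move=> [[x y] z] /= /and3P[].
by apply: finite_setX; first apply: finite_setX; exact: finite_seq.
Qed.

Lemma left_state_weight_finite (zi zj : F) (a b c d e f : spin T) :
  finite_set [set s | left_state_weight zi zj a b c d e f s != 0].
Proof.
apply: sub_finite_set (finite_triples [:: None; a; b; c]) => -[[g h] k] /=.
rewrite !mulf_eq0 !negb_or => /andP[/andP[/rotated_weight_neq0 gk]].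
move=> /vertex_weight_neq0 h0 _; move: gk h0; rewrite !inE.
by move=> /andP[/orP[]/eqP-> /orP[]/eqP->] /andP[_ /or3P[]/eqP->];
  rewrite ?eqxx ?orbT.
Qed.

Lemma right_state_weight_finite (zi zj : F) (a b c d e f : spin T) :
  finite_set [set s | right_state_weight zi zj a b c d e f s != 0].
Proof.
apply: sub_finite_set (finite_triples [:: None; a; b; c]) => -[[j k] l] /=.
rewrite !mulf_eq0 !negb_or => /andP[/andP[/vertex_weight_neq0 jk]].
move=> /vertex_weight_neq0 l0 _; move: jk l0; rewrite !inE.
by move=> /andP[/or3P[]/eqP-> /or3P[]/eqP->] /andP[/or3P[]/eqP-> _];
  rewrite ?eqxx ?orbT.
Qed.

End Weights.

(* Main.v *)
Require Import Defs.
From mathcomp Require Import all_boot all_order all_algebra.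
From mathcomp Require Import all_classical reals.
From mathcomp Require Import complex.
From mathcomp Require Import ring.

(** Once the two incoming edges of a vertex are fixed, at most two pairs of
outgoing edges have nonzero weight, so a vertex is a finite linear combination
of point masses on pairs of spins. Composing these combinations turns both
partition functions into explicit sums over at most eight terms, functions of
the incoming spins [a], [b], [c] and of point masses at [d], [e], [f]; they are
compared for each relative order of the colors among [a], [b], [c]. *)

Set Implicit Arguments.
Unset Strict Implicit.
Unset Printing Implicit Defensive.

Import Order.TTheory GRing.Theory.
Local Open Scope ring_scope.
Local Open Scope complex_scope.

Definition point_mass (F : nzRingType) (I : eqType) (x y : I) : F :=
  (y == x)%:R.

Lemma point_mass_pair (F : nzRingType) (I J : eqType) (x x' : I) (y y' : J) :
  point_mass F (x, y) (x', y') = point_mass F x x' * point_mass F y y'.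
Proof. by rewrite /point_mass xpair_eqE -mulnb natrM. Qed.

Lemma point_mass_eq (F : nzRingType) (I : eqType) (x : I) :
  point_mass F x x = 1.
Proof. by rewrite /point_mass eqxx. Qed.

Lemma point_mass_neq (F : nzRingType) (I : eqType) (x y : I) :
  y != x -> point_mass F x y = 0.
Proof. by rewrite /point_mass => /negbTE ->. Qed.

(** The index type may be infinite, so the sum is first cut down to the finitely many keys of [l].
    The two sums can then be exchanged, and each [q] meets its own key exactly once. Several [q] may
    share a key, hence [undup]. *)
Lemma fsbig_point_mass (F : nzRingType) (I : choiceType) (J : eqType)
    (l : seq J) (w : J -> F) (key : J -> I) :
  \sum_(s \in [set: I]%classic) \sum_(q <- l) w q * point_mass F (key q) s =
  \sum_(q <- l) w q.
Proof.
rewrite -(fsbig_widen [set` undup (map key l)]%classic) //; last first.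
  move=> s [_ snl] /=.
  rewrite big_seq big1 // => q ql; rewrite /point_mass.
  case: (eqVneq s (key q)) => [qs|_]; last by rewrite mulr0.
  by case: snl; rewrite /= mem_undup qs map_f.
rewrite -fsbig_seq ?undup_uniq //.
rewrite exchange_big /= big_seq [RHS]big_seq; apply: eq_bigr => q ql.
rewrite (bigD1_seq (key q)) ?undup_uniq ?mem_undup ?map_f //=.
rewrite /point_mass eqxx mulr1 big1 ?addr0 // => s /negbTE ->.
by rewrite mulr0.
Qed.

Section YangBaxter.
Variables (disp : Order.disp_t) (T : orderType disp) (F : fieldType).
Implicit Types (z zi zj : F) (a b c d e f l t r : spin T).

Let outcome : eqType := (F * (spin T * spin T))%type.

(* An outcome [(w, (r, b))] is the weight [w] of the outgoing edges [(r, b)]. *)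
Definition vertex_outcomes z l t : seq outcome :=
  match l, t with
  | None, None => [:: (1, (None, None))]
  | Some c, None => [:: (z, (Some c, None)); (z, (None, Some c))]
  | None, Some d => [:: (1, (Some d, None))]
  | Some c, Some d => [:: (z, (Some (Order.max c d), Some (Order.min c d)))]
  end.

(** The test [c <= d] merges equal colors with the case [c < d]: both have a single outcome, of
    weight [zi]. *)
Definition rotated_outcomes zi zj bl tl : seq outcome :=
  match bl, tl with
  | None, None => [:: (zj, (None, None))]
  | None, Some d => [:: (zj, (Some d, None))]
  | Some c, None => [:: (zi, (None, Some c)); (zi - zj, (Some c, None))]
  | Some c, Some d =>
      if (c <= d)%O then [:: (zi, (Some d, Some c))]
      else [:: (zj, (Some d, Some c)); (zi - zj, (Some c, Some d))]
  end.

Definition outcome_sum (l : seq outcome) r b : F :=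
  \sum_(o <- l) o.1 * (point_mass F o.2.1 r * point_mass F o.2.2 b).

Lemma vertex_weightE z l t r b :
  vertex_weight z l t r b = outcome_sum (vertex_outcomes z l t) r b.
Proof.
rewrite /outcome_sum /point_mass; case: l t r b => [l|] [t|] [r|] [b|];
  rewrite /= !big_cons big_nil /= ?(inj_eq Some_inj);
  by do ?case: (_ == _); rewrite /= ?(mulr0, mulr1, mul0r, addr0, add0r).
Qed.

Lemma rotated_weightE zi zj bl tl tr br :
  rotated_weight zi zj bl tl tr br =
  outcome_sum (rotated_outcomes zi zj bl tl) tr br.
Proof.
rewrite /outcome_sum /point_mass.
case: bl tl => [l|] [t|]; last 3 first.
1-3: by case: tr br => [r|] [b|]; rewrite /= !big_cons big_nil /=;
  rewrite ?(inj_eq Some_inj);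
  do ?case: (_ == _); rewrite /= ?(mulr0, mulr1, mul0r, addr0, add0r).
case: tr br => [r|] [b|] /=; case: (ltgtP l t) => [lt_lt|lt_tl|<-];
  rewrite !big_cons big_nil /= ?(inj_eq Some_inj) ?(mulr0, mul0r, addr0) //;
  try by do ?case: (_ == _); rewrite /= ?(mulr0, mulr1, mul0r).
(* Only [t < l] remains. Its two outcomes [(t, l)] and [(l, t)] are distinct, so at most one point
   mass survives. *)
case: (eqVneq r t) => [->|_].
  rewrite (lt_eqF lt_tl).
  by case: (b == l); rewrite /= ?(mulr0, mulr1, mul0r, addr0).
by case: (r == l); case: (b == t);
  rewrite /= ?(mulr0, mulr1, mul0r, addr0, add0r).
Qed.

(** An outcome [p] of the rotated vertex fixes [g] and [k]; an outcome [q] of the [zi] vertex then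
    fixes [h]. The edges leaving the [zj] vertex are both on the boundary, so its weight stays a
    plain factor. *)
Lemma left_partition_functionE zi zj a b c d e f :
  left_partition_function zi zj a b c d e f =
  \sum_(p <- rotated_outcomes zi zj a b)
    \sum_(q <- vertex_outcomes zi p.2.1 c)
      p.1 * q.1 * point_mass F q.2.1 d *
        outcome_sum (vertex_outcomes zj p.2.2 q.2.2) e f.
Proof.
pose w (pq : outcome * outcome) : F :=
  pq.1.1 * pq.2.1 * point_mass F pq.2.2.1 d *
    outcome_sum (vertex_outcomes zj pq.1.2.2 pq.2.2.2) e f.
pose key (pq : outcome * outcome) := (pq.1.2.1, pq.2.2.2, pq.1.2.2).
transitivity (\sum_(pq <- [seq (p, q) | p <- rotated_outcomes zi zj a b,
    q <- vertex_outcomes zi p.2.1 c]) w pq); last by rewrite big_allpairs_dep.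
rewrite -(fsbig_point_mass _ w key); apply: eq_fsbigr => -[[g h] k] _ /=.
rewrite big_allpairs_dep rotated_weightE !mulr_suml; apply: eq_bigr => p _.
rewrite !vertex_weightE /w /key /=.
(* A state that disagrees with [p] has a vanishing point mass on both sides. *)
case: (eqVneq g p.2.1) => [->|neq]; last first.
  rewrite (point_mass_neq _ neq) !(mul0r, mulr0) big1 // => q _.
  by rewrite !point_mass_pair (point_mass_neq _ neq) !(mul0r, mulr0).
case: (eqVneq k p.2.2) => [->|neq]; last first.
  rewrite (point_mass_neq _ neq) !(mul0r, mulr0) big1 // => q _.
  by rewrite !point_mass_pair (point_mass_neq _ neq) !(mul0r, mulr0).
rewrite !point_mass_eq !mulr1 {1}/outcome_sum mulr_sumr mulr_suml.
apply: eq_bigr => q _; rewrite !point_mass_pair !point_mass_eq !(mul1r, mulr1).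
case: (eqVneq h q.2.2) => [->|neq].
  by rewrite point_mass_eq ?mul1r !mulr1 !mulrA.
by rewrite (point_mass_neq _ neq) !(mul0r, mulr0).
Qed.

(** Here the [zj] vertex fixes the first two interior edges, the [zi] vertex the third, and the
    rotated vertex comes last. *)
Lemma right_partition_functionE zi zj a b c d e f :
  right_partition_function zi zj a b c d e f =
  \sum_(p <- vertex_outcomes zj b c)
    \sum_(q <- vertex_outcomes zi a p.2.2)
      p.1 * q.1 * point_mass F q.2.2 f *
        outcome_sum (rotated_outcomes zi zj q.2.1 p.2.1) d e.
Proof.
pose w (pq : outcome * outcome) : F :=
  pq.1.1 * pq.2.1 * point_mass F pq.2.2.2 f *
    outcome_sum (rotated_outcomes zi zj pq.2.2.1 pq.1.2.1) d e.
pose key (pq : outcome * outcome) := (pq.1.2.1, pq.1.2.2, pq.2.2.1).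
transitivity (\sum_(pq <- [seq (p, q) | p <- vertex_outcomes zj b c,
    q <- vertex_outcomes zi a p.2.2]) w pq); last by rewrite big_allpairs_dep.
rewrite -(fsbig_point_mass _ w key); apply: eq_fsbigr => -[[j k] l] _ /=.
rewrite big_allpairs_dep !vertex_weightE !mulr_suml; apply: eq_bigr => p _.
rewrite rotated_weightE /w /key /=.
case: (eqVneq j p.2.1) => [->|neq]; last first.
  rewrite (point_mass_neq _ neq) !(mul0r, mulr0) big1 // => q _.
  by rewrite !point_mass_pair (point_mass_neq _ neq) !(mul0r, mulr0).
case: (eqVneq k p.2.2) => [->|neq]; last first.
  rewrite (point_mass_neq _ neq) !(mul0r, mulr0) big1 // => q _.
  by rewrite !point_mass_pair (point_mass_neq _ neq) !(mul0r, mulr0).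
rewrite !point_mass_eq !mulr1 {1}/outcome_sum mulr_sumr mulr_suml.
apply: eq_bigr => q _; rewrite !point_mass_pair !point_mass_eq !(mul1r, mulr1).
case: (eqVneq l q.2.1) => [->|neq].
  by rewrite point_mass_eq ?mul1r !mulr1 !mulrA.
by rewrite (point_mass_neq _ neq) !(mul0r, mulr0).
Qed.

(** Evaluating one vertex exposes the color comparisons of the next, so reduction and rewriting have
    to alternate. *)
Ltac simp_comparisons :=
  repeat first
    [ progress rewrite ?big_cons ?big_nil ?ltxx ?lexx /=
    | match goal with H : is_true (_ < _)%O |- _ =>
        progress rewrite ?H ?(lt_gtF H) ?(ltW H) ?(lt_geF H) /=
      end ].

Lemma yang_baxter zi zj a b c d e f :
  left_partition_function zi zj a b c d e f =
  right_partition_function zi zj a b c d e f.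
Proof.
rewrite left_partition_functionE right_partition_functionE.
(* The spins [d], [e], [f] occur only inside point masses, which [ring] treats as atoms, so they
   need no case analysis. *)
case: a b c => [a|] [b|] [c|]; rewrite /outcome_sum.
all: rewrite /vertex_outcomes /rotated_outcomes /Order.max /Order.min.
all: try (case: (ltgtP a b) => [ab|ba|?]; try subst a).
all: try (case: (ltgtP b c) => [bc|cb|?]; try subst b).
all: try (case: (ltgtP a c) => [ac|ca|?]; try subst a).
(* The three comparisons were split independently; contradictory combinations, such as the cycle
   [a < b < c < a], are discarded here. *)
all: try by rewrite (lt_gtF ab) in ca.
all: try by rewrite (lt_gtF ab) in bc.
all: try by rewrite (lt_gtF ba) in cb.
all: try by rewrite (lt_gtF (lt_trans ab bc)) in ca.
all: try by rewrite (lt_gtF (lt_trans cb ba)) in ac.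
all: by simp_comparisons; ring.
Qed.

End YangBaxter.

Theorem theorem4p2 (R : realType) (disp : Order.disp_t) (T : orderType disp)
    (zi zj : R[i]) (hzi : zi != 0) (hzj : zj != 0) (a b c d e f : spin T) :
  left_partition_function zi zj a b c d e f =
  right_partition_function zi zj a b c d e f.
Proof.
exact: yang_baxter.
Qed.
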